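(* Let $G$ be a connected Lie group, and let $n,m$ be positive integers. Then $$\mathcal{E}_n(G)\cap\mathcal{E}_m(G)=\mathcal{E}_{(n,m)}(G).$$ In particular, if $n$ divides $m$, then $\mathcal{E}_n(G)\subset\mathcal{E}_m(G)$.
   Context: Lie groups are real and finite-dimensional; $e$ is the identity element. For a positive integer $k$, $E_k(G)=\{g\in G\mid g^k=e\}$ with the subspace topology from $G$, and $\mathcal{E}_k(G)$ denotes the set of all connected components of $E_k(G)$; thus $\mathcal{E}_k(G)$ is a set whose elements are subsets of $G$, and the intersection and inclusion in the claim are those of such sets of subsets. $(n,m)$ denotes the greatest common divisor of $n$ and $m$. *)

(* Defs.v *)
From HB Require Import structures.
From mathcomp Require Import all_boot all_order all_algebra.
From mathcomp Require Import all_classical all_reals all_analysis.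
Import Order.TTheory GRing.Theory Num.Theory.
Import numFieldNormedType.Exports.

Set Implicit Arguments.
Unset Strict Implicit.
Unset Printing Implicit Defensive.

Local Open Scope classical_set_scope.
Local Open Scope ring_scope.

(* [Ck_on k U f]: f is of class C^k on U.  U is meant to be open, so that the
   values of f outside U are irrelevant.  In finite dimension the differential
   is C^k as soon as each v |-> 'D_v f is. *)
Fixpoint Ck_on (R : realType) (E F : normedModType R) (k : nat) (U : set E)
    (f : E -> F) : Prop :=
  match k with
  | 0%N => forall x, U x -> {for x, continuous f}
  | k'.+1 => (forall x, U x -> differentiable f x) /\
             (forall v : E, Ck_on k' U ('D_v f))
  end.

Definition smooth_on (R : realType) (E F : normedModType R) (U : set E)
    (f : E -> F) : Prop :=
  forall k : nat, Ck_on k U f.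

(* Charts on M modelled on E: both maps are total, but only the values of
   [coord] on [dom] and those of [param] on [coord @` dom] are meaningful. *)
Record chart (E M : Type) := Chart {
  dom : set M ;
  coord : M -> E ;
  param : E -> M
}.

Definition prod_chart (E F M N : Type) (a : chart E M) (b : chart F N) :
    chart (E * F) (M * N) :=
  Chart (dom a `*` dom b)
        (fun p => (coord a p.1, coord b p.2))
        (fun q => (param a q.1, param b q.2)).

Definition prod_atlas (E F M N : Type) (A : set (chart E M))
    (B : set (chart F N)) : set (chart (E * F) (M * N)) :=
  [set prod_chart a b | a in A & b in B].

Section Manifold.
Context {R : realType}.

Definition is_chart (E : normedModType R) (M : topologicalType)
    (a : chart E M) : Prop :=
  [/\ open (dom a),
      open (coord a @` dom a),
      (forall x, dom a x -> param a (coord a x) = x),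
      (forall x, dom a x -> {for x, continuous (coord a)}) &
      (forall y, (coord a @` dom a) y -> {for y, continuous (param a)})].

(* A smooth atlas, not required to be maximal. *)
Definition is_smooth_atlas (E : normedModType R) (M : topologicalType)
    (A : set (chart E M)) : Prop :=
  [/\ (forall a, A a -> is_chart a),
      (forall x : M, exists2 a, A a & dom a x) &
      (forall a b, A a -> A b ->
        smooth_on (coord a @` (dom a `&` dom b)) (coord b \o param a))].

Definition smooth_map (E F : normedModType R) (M N : topologicalType)
    (A : set (chart E M)) (B : set (chart F N)) (f : M -> N) : Prop :=
  continuous f /\
  forall a b, A a -> B b ->
    smooth_on (coord a @` (dom a `&` f @^-1` dom b))
              (coord b \o f \o param a).

End Manifold.

#[short(type="preTopologicalGroupType")]
HB.structure Definition PreTopologicalGroup :=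
  {G of Group G & Topological G}.

HB.mixin Record isLieGroup (R : realType) G & PreTopologicalGroup G := {
  lie_dim : nat ;
  lie_atlas : set (chart 'rV[R]_lie_dim G) ;
  lie_hausdorff : hausdorff_space G ;
  lie_second_countable : @second_countable G ;
  lie_smooth_atlas : is_smooth_atlas lie_atlas ;
  lie_mul_smooth :
    smooth_map (prod_atlas lie_atlas lie_atlas) lie_atlas
      (fun p : G * G => (p.1 * p.2)%g) ;
  lie_inv_smooth : smooth_map lie_atlas lie_atlas (fun x : G => (x^-1)%g)
}.

#[short(type="lieGroupType")]
HB.structure Definition LieGroup (R : realType) :=
  {G of isLieGroup R G & PreTopologicalGroup G}.

Definition E_ (k : nat) (G : preTopologicalGroupType) : set G :=
  [set g : G | (g ^+ k = 1)%g].
Arguments E_ k G : clear implicits.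

Definition components (T : topologicalType) (A : set T) : set (set T) :=
  [set connected_component A x | x in A].

(* Main.v *)
Require Import Defs.
From mathcomp Require Import all_boot all_order all_algebra.
From mathcomp Require Import all_classical all_reals all_analysis.
Import Order.TTheory GRing.Theory Num.Theory.
Import numFieldNormedType.Exports.

Local Open Scope classical_set_scope.

(** The point is that E_ d G is both open and closed in E_ n G whenever d divides
    n > 0.  It is closed because G is Hausdorff and powers are continuous.  It is
    open because G has no small torsion: if x ^+ n = 1, then y = x ^+ d satisfies
    y ^+ (n / d) = 1, and near the identity y = 1 is the only solution of that
    equation ([no_small_torsion]).  A connected subset of E_ n G that meets
    E_ d G is therefore contained in it, so a point of E_ d G has the same
    component in E_ d G as in E_ n G ([connected_component_E]).

    This gives the inclusion from right to left, and the last claim.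
    Conversely, a common component of E_ n G and E_ m G is the component in E_ n G
    of some x lying in both sets; by Bezout x is in E_ (gcdn n m) G, and the same
    lemma identifies the set with a component of E_ (gcdn n m) G.

    Absence of small torsion needs no exponential map: read in a chart around the
    identity, the product has differential (h, k) |-> h + k at the identity,
    because the identity is a two-sided unit.  So the k-th power has differential
    h |-> h *+ k there, and a map whose differential at a point is bounded below
    takes its value at that point only once nearby. *)

Section UnitalOperation.
Local Open Scope ring_scope.
Context {R : realType} {E : normedModType R}.
Implicit Types (mu : E * E -> E) (p : E).

(** On each of the slices through p the operation is locally the identity map,
    which determines the differential on the two axes; linearity does the rest. *)
Lemma is_diff_unital mu p :
    differentiable mu (p, p) ->
    (\forall u \near p, mu (u, p) = u) ->
    (\forall u \near p, mu (p, u) = u) ->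
  is_diff (p, p) mu (fun h => h.1 + h.2).
Proof.
move=> dmu mur mul; apply: DiffDef => //; apply/funext => -[h k] /=.
(* g is one of the two inclusions u |-> (u, p) and u |-> (p, u). *)
have dcomp (g : E -> E * E) (dg : E -> E * E) : g p = (p, p) ->
    is_diff p g dg -> (\forall u \near p, mu (g u) = u) ->
    forall v, 'd mu (p, p) (dg v) = v.
  move=> gp gdiff near_id v.
  have dmug : differentiable mu (g p) by rewrite gp.
  have dmugP : is_diff (g p) mu ('d mu (g p)) by exact: differentiableP.
  have compP : is_diff p (mu \o g) ('d mu (g p) \o dg) by exact: is_diff_comp.
  have := @near_eq_derive _ _ _ (mu \o g) id p v near_id.
  rewrite deriveE; last by case: compP.
  rewrite deriveE; last by case: (is_diff_id p).
  rewrite (@diff_val _ _ _ _ _ _ _ compP).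
  by rewrite (@diff_val _ _ _ _ _ _ _ (is_diff_id p)) /= gp.
have dl : 'd mu (p, p) (h, 0) = h.
  exact: (dcomp (fun u => (u, p)) (fun v => (v, 0))).
have dr : 'd mu (p, p) (0, k) = k.
  exact: (dcomp (fun u => (p, u)) (fun v => (0, v))).
rewrite -[in RHS]dl -[in RHS]dr -linearD.
by congr ('d mu _ _); apply/pair_equal_spec; rewrite addr0 add0r.
Qed.

(** The k-th power map of a local operation with unit p.  Being an iterate of mu
    on all of E, it can be differentiated by the chain rule, whereas the power
    map of the group is only expressible through the chart near p. *)
Definition local_pow mu p k (u : E) := iter k (fun v => mu (u, v)) p.

Lemma local_pow_unit mu p k : mu (p, p) = p -> local_pow mu p k p = p.
Proof. by rewrite /local_pow => mupp; elim: k => //= k ->. Qed.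

Lemma is_diff_local_pow mu p k :
    mu (p, p) = p -> is_diff (p, p) mu (fun h => h.1 + h.2) ->
  is_diff p (local_pow mu p k) (fun h => h *+ k).
Proof.
move=> mupp dmu; elim: k => [|k IHk].
  exact: (is_diff_cst p p).
have dpair : is_diff p (fun u => (u, local_pow mu p k u))
    (fun h => (h, h *+ k)) by exact: is_diff_pair.
have dmu' : is_diff (p, local_pow mu p k p) mu (fun h => h.1 + h.2).
  by rewrite local_pow_unit.
have := @is_diff_comp _ _ _ _ _ _ mu _ p dpair dmu'.
by congr (is_diff_def _ _ _); apply/funext => h /=; rewrite mulrS.
Qed.

(** If f (p + h) = f p, then h *+ k is o(h), hence `|h| <= `|h| / 2 for small h. *)
Lemma diff_mulrn_isolated (f : E -> E) p k : (0 < k)%N ->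
  is_diff p f (fun h => h *+ k) -> \forall u \near p, f u = f p -> u = p.
Proof.
move=> k_gt0 df; have /diff_locallyx := @ex_diff _ _ _ _ _ _ _ df.
rewrite diff_val => fE.
have half_gt0 : 0 < 2^-1 :> R by rewrite invr_gt0.
rewrite (near_shift 0) /= subr0.
have /eqaddoP/(_ _ half_gt0) :
    f \o shift p = cst (f p) + (fun h => h *+ k) +o_ 0 id.
  by apply: eqaddoE; apply/funext => h; exact: fE.
apply: filterS => h /= + fhp.
rewrite !fctE /= fhp opprD addrA subrr add0r normrN normrMn => hle.
have [->|h_neq0] := eqVneq h 0; first by rewrite add0r.
have : `|h| <= 2^-1 * `|h|.
  by apply: le_trans hle; rewrite -mulr_natl ler_peMl// ler1n.
by rewrite leNgt gtr_pMl ?normr_gt0// invf_lt1// ltr1n.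
Qed.

End UnitalOperation.

Section LieGroup.
Context {R : realType} {G : lieGroupType R}.

Lemma continuous_expg k : continuous (fun x : G => (x ^+ k)%g).
Proof.
elim: k => [|k IHk] x; first exact: cvg_cst.
have -> : (fun y : G => (y ^+ k.+1)%g) = (fun y : G => (y * y ^+ k)%g).
  by apply/funext => y; rewrite expgS.
have [mulC _] := @lie_mul_smooth R G.
apply: (@continuous_comp _ _ _ (fun y : G => (y, y ^+ k)%g) _ x
  (cvg_pair _ _) (mulC _)).
  exact: cvg_id.
exact: IHk.
Qed.

(** In a chart at the identity, the power map is [local_pow] of the product, so
    its fibre over the identity is isolated by [diff_mulrn_isolated]. *)
Lemma no_small_torsion k : (0 < k)%N ->
  \forall x \near (1%g : G), (x ^+ k = 1)%g -> x = 1%g.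
Proof.
move=> k_gt0.
have [charts cover _] := @lie_smooth_atlas R G.
have [_ mul_smooth] := @lie_mul_smooth R G.
have [a Aa a1] := cover 1%g.
have [dom_open im_open paramK coord_cont _] := charts a Aa.
pose p := Defs.coord a 1%g.
pose mu q := Defs.coord a (param a q.1 * param a q.2)%g.
have mu_diff : differentiable mu (p, p).
  (* One level of smoothness already gives differentiability. *)
  have [+ _] := mul_smooth _ a (ex_intro2 _ _ a Aa (ex_intro2 _ _ a Aa erefl)) Aa 1%N.
  by apply; exists (1%g, 1%g) => //; split => //=; rewrite mulg1.
have p_im : (Defs.coord a @` dom a) p by exists 1%g.
have im_near : \forall u \near p, (Defs.coord a @` dom a) u.
  exact: open_nbhs_nbhs.
have param_p : param a p = 1%g by exact: paramK.
have mur : \forall u \near p, mu (u, p) = u.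
  apply: filterS im_near => _ [x ax <-].
  by rewrite /mu /= param_p mulg1 paramK.
have mul : \forall u \near p, mu (p, u) = u.
  apply: filterS im_near => _ [x ax <-].
  by rewrite /mu /= param_p mul1g paramK.
have mupp : mu (p, p) = p by exact: nbhs_singleton mur.
have dmu := is_diff_unital _ _ mu_diff mur mul.
have isolated := diff_mulrn_isolated _ _ _ k_gt0
  (is_diff_local_pow _ _ k mupp dmu).
have dom_near j : \forall x \near (1%g : G), dom a (x ^+ j)%g.
  apply: (continuous_expg j 1%g); rewrite expg1n.
  exact: open_nbhs_nbhs.
(* How close x must be depends on j: x and its powers below the j-th all have
   to lie in the domain of the chart. *)
have local_powE j : \forall x \near (1%g : G),
    local_pow mu p j (Defs.coord a x) = Defs.coord a (x ^+ j)%g.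
  elim: j => [|j IHj]; first by apply: nearW => x; rewrite expg0.
  near=> x.
  rewrite /local_pow /= -/(local_pow mu p j _) (near IHj x)//.
  rewrite /mu /= !paramK -?expgS//.
    by near: x; exact: dom_near.
  by near: x; apply: filterS (dom_near 1%N) => y; rewrite expg1.
near=> x => xk1.
have ax : dom a x.
  by near: x; apply: filterS (dom_near 1%N) => y; rewrite expg1.
rewrite -[x]paramK// -[RHS]param_p; congr (param a _).
suff : local_pow mu p k (Defs.coord a x) = local_pow mu p k p -> Defs.coord a x = p.
  apply; rewrite local_pow_unit//.
  by rewrite (near (local_powE k) x)// xk1.
by near: x; exact: (coord_cont _ a1 _ isolated).
Unshelve. all: by end_near. Qed.

Lemma E_dvdn d n : (d %| n)%N -> E_ d G `<=` E_ n G.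
Proof.
by move=> /dvdnP[q ->] x; rewrite /E_ /= => xd; rewrite mulnC expgnA xd expg1n.
Qed.

Lemma E_gcdn n m : (0 < n)%N -> E_ n G `&` E_ m G = E_ (gcdn n m) G.
Proof.
move=> n_gt0; apply/seteqP; split=> x; last first.
  by move=> xd; split; apply: E_dvdn xd; rewrite ?dvdn_gcdl ?dvdn_gcdr.
rewrite /E_ /= => -[xn xm]; have [a b ab _] := egcdnP m n_gt0.
have : (x ^+ (a * n) = x ^+ (b * m) * x ^+ gcdn n m)%g by rewrite -expgnDr ab.
by rewrite ![(_ * n)%N]mulnC ![(_ * m)%N]mulnC !expgnA xn xm !expg1n mul1g.
Qed.

Lemma E_closed k : closed (E_ k G).
Proof.
have -> : E_ k G = (fun x : G => (x ^+ k)%g) @^-1` [set 1%g] by [].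
apply: closed_comp; first by move=> x _; exact: continuous_expg.
exact/accessible_closed_set1/hausdorff_accessible/lie_hausdorff.
Qed.

(** For x in E_ n G, the power x ^+ d has order dividing n / d, so it is trivial
    as soon as it is close to the identity. *)
Lemma E_relatively_open d n : (0 < n)%N -> (d %| n)%N ->
  exists2 U, open U & E_ d G = E_ n G `&` U.
Proof.
move=> n_gt0 /dvdnP[q nqd].
have q_gt0 : (0 < q)%N by move: n_gt0; rewrite nqd; case: (q).
have small := no_small_torsion _ q_gt0.
pose V := [set x : G | x ^+ q = 1 -> x = 1]%g.
exists ((fun x : G => (x ^+ d)%g) @^-1` interior V).
  apply: open_comp; last exact: open_interior.
  by move=> x _; exact: continuous_expg.
apply/seteqP; split=> x; rewrite /E_ /=.
  move=> xd; split; first by rewrite nqd mulnC expgnA xd expg1n.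
  by rewrite xd.
by move=> [xn /interior_subset]; apply; rewrite -expgnA mulnC -nqd.
Qed.

(** E_ d G is clopen in E_ n G, so the component of x in the larger set cannot
    leave the smaller one. *)
Lemma connected_component_E d n x : (0 < n)%N -> (d %| n)%N -> E_ d G x ->
  connected_component (E_ d G) x = connected_component (E_ n G) x.
Proof.
move=> n_gt0 dn dx; have nx := E_dvdn _ _ dn _ dx.
have [U U_open EdU] := E_relatively_open _ _ n_gt0 dn.
set C := connected_component (E_ n G) x.
have CEn : C `<=` E_ n G by exact: connected_component_sub.
have Cx : C x by exact: connected_component_refl.
have C_conn : connected C by exact: component_connected.
have CEd : C `&` E_ d G = C.
  apply: C_conn.
  - by exists x.
  - exists U => //; rewrite EdU setIA; congr (_ `&` _).
    exact/setIidPl.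
  - by exists (E_ d G) => //; exact: E_closed.
apply/seteqP; split.
  apply: connected_component_max; last exact: component_connected.
    exact: connected_component_refl.
  by apply: subset_trans (E_dvdn _ _ dn); exact: connected_component_sub.
apply: connected_component_max => //.
by rewrite -CEd; exact: subIsetr.
Qed.

Lemma components_E_dvdn d n : (0 < n)%N -> (d %| n)%N ->
  components (E_ d G) `<=` components (E_ n G).
Proof.
move=> n_gt0 dn _ [x dx <-]; exists x; first exact: E_dvdn dn _ dx.
exact/esym/connected_component_E.
Qed.

End LieGroup.

Theorem corollary4p2 (R : realType) (G : lieGroupType R)
    (G_connected : connected [set: G])
    (n m : nat) (n_gt0 : (0 < n)%N) (m_gt0 : (0 < m)%N) :
  components (E_ n G) `&` components (E_ m G) = components (E_ (gcdn n m) G) /\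
  ((n %| m)%N -> components (E_ n G) `<=` components (E_ m G)).
Proof.
split; last exact: components_E_dvdn.
apply/seteqP; split=> [C [[x nx <-] [y my Cyx]]|C CE]; last first.
  by split; apply: components_E_dvdn CE; rewrite ?dvdn_gcdl ?dvdn_gcdr.
have mx : E_ m G x.
  apply: (@connected_component_sub _ _ y); rewrite Cyx.
  exact: connected_component_refl.
have dx : E_ (gcdn n m) G x by rewrite -E_gcdn.
by exists x => //; apply: connected_component_E; rewrite ?dvdn_gcdl.
Qed.
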